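(* Let $X$ be a compact Kähler manifold of complex dimension $n\ge 1$ and let $\omega$ be a smooth closed semi-positive real $(1,1)$-form on $X$ with $\int_X\omega^n=1$. Let $p\ge 1$ and $q>0$ be real numbers, and let $\mu$ be a probability measure on $X$. Suppose that there are constants $A>0$ and $\alpha$ with $\frac{q}{p+n}<\alpha<1$ such that $\mu(B)\le A\,C_\omega(B)^\alpha$ for every Borel set $B\subset X$. Then $$\mathcal{C}h^p(X,\omega)\subset L^q(\mu).$$
   Context: $d=\partial+\overline\partial$, and $d^c$ is normalized so that $dd^c=\frac{i}{\pi}\partial\overline\partial$. $PSH(X,\omega)$ is the set of functions $\varphi:X\to\mathbb{R}\cup\{-\infty\}$ that are locally the sum of a plurisubharmonic and a smooth function and satisfy $\omega_\varphi:=\omega+dd^c\varphi\ge 0$ as a current. For bounded $u\in PSH(X,\omega)$, $MA(u)=\omega_u^n$ is the Bedford–Taylor Monge–Ampère probability measure. The Monge–Ampère capacity of a Borel set $K\subset X$ is $$C_\omega(K)=\sup\left\{\int_K MA(u)\;:\;u\in PSH(X,\omega),\ -1\le u\le 0\right\},$$ and for a Borel function $f\ge 0$ and $r\ge 1$, $\int_X f^r\,dC_\omega=r\int_0^{+\infty}t^{r-1}C_\omega(\{f\ge t\})\,dt$. The Choquet–Monge–Ampère class is $$\mathcal{C}h^p(X,\omega)=\left\{\varphi\in PSH(X,\omega)\;:\;\int_X|\varphi|^{p+n}\,dC_\omega<+\infty\right\}.$$ $L^q(\mu)$ denotes the functions $f$ with $\int_X|f|^q\,d\mu<+\infty$. 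*)

(* Defs.v *)
From HB Require Import structures.
From mathcomp Require Import all_boot all_order all_algebra.
From mathcomp Require Import all_classical all_reals all_analysis.
From mathcomp Require Import measurable_realfun.
Import Order.TTheory GRing.Theory Num.Theory.
Import numFieldNormedType.Exports.
Set Implicit Arguments.
Unset Strict Implicit.
Unset Printing Implicit Defensive.
Local Open Scope classical_set_scope.
Local Open Scope ring_scope.

Section LebesgueTuple.
Variable R : realType.
Local Notation RR := (measurableTypeR R).

Definition consR k (p : RR * k.-tuple RR) : k.+1.-tuple RR :=
  [the k.+1.-tuple RR of p.1 :: p.2].

Lemma measurable_consR k : measurable_fun setT (@consR k).
Proof. exact: measurable_cons. Qed.

Section step.
Variables (k : nat) (m : {sigma_finite_measure set (k.-tuple RR) -> \bar R}).

Definition lebesgue_cons : set (k.+1.-tuple RR) -> \bar R :=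
  pushforward (@lebesgue_measure R \x m)%E (@consR k).

Let lebesgue_cons_sigma_finite : sigma_finite setT lebesgue_cons.
Proof.
have /sigma_finiteP[F [TF ndF Foo]] := sigma_finiteT (@lebesgue_measure R).
have /sigma_finiteP[G [TG ndG Goo]] := sigma_finiteT m.
pose unc (t : k.+1.-tuple RR) : RR * k.-tuple RR :=
  (tnth t ord0, [tuple of behead t]).
have muncons : measurable_fun setT unc.
  by apply: measurable_fun_pair;
     [exact: measurable_tnth|exact: measurable_behead].
have uncK : cancel (@consR k) unc.
  move=> [x t]; rewrite /unc /consR /=; congr pair; apply: val_inj => //.
exists (fun i => unc @^-1` (F i `*` G i)).
  apply/esym; rewrite -preimage_bigcup -subTset => t _.
  have [i _ Fi] : (\bigcup_i F i) (unc t).1 by rewrite -TF.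
  have [j _ Gj] : (\bigcup_i G i) (unc t).2 by rewrite -TG.
  exists (maxn i j) => //; split.
    by move: Fi; exact/subsetPset/ndF/leq_maxl.
  by move: Gj; exact/subsetPset/ndG/leq_maxr.
move=> i; have [mF Fi] := Foo i; have [mG Gi] := Goo i; split.
  by rewrite -[X in measurable X]setTI; apply: muncons => //; exact: measurableX.
rewrite /lebesgue_cons /pushforward -comp_preimage.
rewrite (_ : unc \o _ = id); last by apply/funext => x; exact: uncK.
by rewrite preimage_id product_measure1E// lte_mul_pinfty// ge0_fin_numE.
Qed.

Let nu : {measure set (k.+1.-tuple RR) -> \bar R} :=
  measure_function_pushforward__canonical__measure_function_Measure
     (@lebesgue_measure R \x m)%E (@measurable_consR k).

Let lebesgue_cons0 : lebesgue_cons set0 = 0%E. Proof. exact: (measure0 nu). Qed.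

Let lebesgue_cons_ge0 A : (0 <= lebesgue_cons A)%E.
Proof. exact: (measure_ge0 nu). Qed.

Let lebesgue_cons_sigma_additive : semi_sigma_additive lebesgue_cons.
Proof. exact: (@measure_semi_sigma_additive _ _ _ nu). Qed.

HB.instance Definition _ := isMeasure.Build _ _ _ lebesgue_cons
  lebesgue_cons0 lebesgue_cons_ge0 lebesgue_cons_sigma_additive.

HB.instance Definition _ := Measure_isSigmaFinite.Build _ _ _ lebesgue_cons
  lebesgue_cons_sigma_finite.

End step.

Fixpoint lebesgue_tuple k : {sigma_finite_measure set (k.-tuple RR) -> \bar R} :=
  match k with
  | 0 => \d_ [tuple]
  | k'.+1 => lebesgue_cons (lebesgue_tuple k')
  end.

End LebesgueTuple.

Notation borel T := (g_sigma_algebraType (@open T)).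

(* C^n is encoded as the real n x 2 matrices: row j holds the real and the
   imaginary part of the j-th coordinate.  As [vec_mx] is row-major, the real
   coordinates come in the order x_1, y_1, ..., x_n, y_n, which is the complex
   orientation. *)
Notation Cn R n := 'M[R]_(n, 2).

Section ComplexSpace.
Variables (R : realType) (n : nat).
Implicit Types (W K : set (Cn R n)) (z a xi eta : Cn R n) (chi : Cn R n -> R).

(* Multiplication by the imaginary unit. *)
Definition mulI xi : Cn R n :=
  \matrix_(j, s) (if s == 0 then - xi j 1 else xi j 0).

Definition basis_vec (a : 'I_(n * 2)) : Cn R n := vec_mx (delta_mx 0 a).

Definition vol_int W (f : Cn R n -> \bar R) : \bar R :=
  let pt (t : (n * 2).-tuple (measurableTypeR R)) : Cn R n :=
    vec_mx (\row_a tnth t a) in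
  (\int[lebesgue_tuple R (n * 2)]_(t in pt @^-1` W) f (pt t))%E.

Definition smooth_on W (f : Cn R n -> R) :=
  forall (s : seq (Cn R n)) z, W z ->
    let g := foldr (fun v h => 'D_v h) f s in
    {for z, continuous g} /\ forall v, derivable g z v.

Definition test_function W chi :=
  smooth_on setT chi /\
  exists K, [/\ compact K, K `<=` W & forall z, ~ K z -> chi z = 0].

(* Cauchy-Riemann: a map is holomorphic on an open subset of C^n
   iff it has a complex-linear real differential at each point. *)
Definition holomorphic_on W (f : Cn R n -> Cn R n) :=
  forall z, W z ->
    differentiable f z /\ forall xi, 'd f z (mulI xi) = mulI ('d f z xi).

Definition disc_pt a xi (r t : R) : Cn R n :=
  a + r *: (cos t *: xi + sin t *: mulI xi).

Definition psh_on W (psi : Cn R n -> \bar R) :=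
  [/\ forall z, W z -> (psi z < +oo)%E,
      forall z (b : \bar R), W z -> (psi z < b)%E ->
        \forall w \near z, (psi w < b)%E,
      forall z, W z -> exists2 w, connected_component W z w & psi w != -oo%E
    & forall a xi,
        (forall r t : R, 0 <= r <= 1 -> W (disc_pt a xi r t)) ->
        (psi a <= ((2 * pi)^-1)%R%:E *
           \int[@lebesgue_measure R]_(t in `[0%R, (2 * pi)%R]%classic)
             psi (disc_pt a xi 1 t))%E].

(* With d^c = (i / 2 pi) (dbar - d'), one has
   d^c chi (xi) = - (2 pi)^-1 d chi (mulI xi), and
   d d^c = (i / pi) d' dbar. *)
Definition ddc chi z xi eta : R :=
  - (2 * pi)^-1 *
    ('D_xi ('D_(mulI eta) chi) z - 'D_eta ('D_(mulI xi) chi) z).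

(* The integrand of the pairing of omega + dd^c u with chi: dd^c is moved onto
   the test function. *)
Definition pairing (omega : Cn R n -> Cn R n -> Cn R n -> R)
    (u : Cn R n -> \bar R) chi xi eta z : \bar R :=
  ((chi z * omega z xi eta)%:E + u z * (ddc chi z xi eta)%:E)%E.

(* A signed Radon measure on W, as a difference of two positive ones. *)
Definition signed_measure :=
  ({measure set (borel (Cn R n)) -> \bar R} *
   {measure set (borel (Cn R n)) -> \bar R})%type.

Definition radon_on W (t : signed_measure) :=
  forall K, compact K -> K `<=` W -> (t.1 K < +oo)%E /\ (t.2 K < +oo)%E.

Definition signed_int W (t : signed_measure) (f : Cn R n -> \bar R) : \bar R :=
  (\int[t.1]_(z in W) f z - \int[t.2]_(z in W) f z)%E.

(* dx_I = orientation I dx_1 /\ dy_1 /\ ... /\ dx_n /\ dy_n for size I = 2n. *)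
Definition orientation (I : seq 'I_(n * 2)) : R :=
  \det (\matrix_(i < n * 2, j < n * 2) (onth I i == Some j)%:R).

(* The inductive Bedford-Taylor definition of the currents
   T_k = (omega + dd^c u)^k for bounded u:
     T_0 = 1  and  T_(k+1) = omega /\ T_k + dd^c (u T_k).
   A current of degree 2k with measure coefficients is given by the signed
   measures T k I = T_k /\ dx_I, for I a sequence of 2 (n - k) real
   coordinates.  A 2-form theta is
   2^-1 * \sum_(a, b) theta (e_a, e_b) dx_a /\ dx_b, and
   < dd^c (u T_k), chi dx_I > = < u T_k, dd^c chi /\ dx_I >. *)
Definition bedford_taylor W (omega : Cn R n -> Cn R n -> Cn R n -> R)
    (u : Cn R n -> \bar R) (T : nat -> seq 'I_(n * 2) -> signed_measure) :=
  [/\ forall k I, (k <= n)%N -> size I = ((n - k) * 2)%N -> radon_on W (T k I),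
      forall I chi, size I = (n * 2)%N -> test_function W chi ->
        signed_int W (T 0%N I) (EFin \o chi) =
        ((orientation I)%:E * vol_int W (EFin \o chi))%E
    & forall k I chi, (k < n)%N -> size I = ((n - k.+1) * 2)%N ->
        test_function W chi ->
        signed_int W (T k.+1 I) (EFin \o chi) =
        ((2^-1)%R%:E * \sum_a \sum_b
          signed_int W (T k [:: a, b & I])
            (pairing omega u chi (basis_vec a) (basis_vec b)))%E].

End ComplexSpace.

Section Manifold.
Variables (R : realType) (X : ptopologicalType) (n : nat).

Record chart := Chart {
  cdom : set X;
  cimg : set (Cn R n);
  cmap : X -> Cn R n;
  cinv : Cn R n -> X;
  cdom_open : open cdom;
  cimg_open : open cimg;
  cmap_img : forall x, cdom x -> cimg (cmap x);
  cinv_dom : forall z, cimg z -> cdom (cinv z);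
  cmapK : forall x, cdom x -> cinv (cmap x) = x;
  cinvK : forall z, cimg z -> cmap (cinv z) = z;
  cmap_continuous : forall x, cdom x -> {for x, continuous cmap};
  cinv_continuous : forall z, cimg z -> {for z, continuous cinv} }.

Definition overlap (c c' : chart) : set (Cn R n) :=
  [set z | cimg c z /\ cdom c' (cinv c z)].

Record complex_atlas := ComplexAtlas {
  charts : set chart;
  charts_cover : forall x, exists2 c, charts c & cdom c x;
  transition_holomorphic : forall c c', charts c -> charts c' ->
    holomorphic_on (overlap c c') (cmap c' \o cinv c) }.

Variable A : complex_atlas.

(* Smooth real (1,1)-forms: real 2-forms, given by their expressions in the
   charts of the atlas, that are invariant under the complex structure. *)
Record form11 := Form11 {
  form :> chart -> Cn R n -> Cn R n -> Cn R n -> R;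
  form_linear : forall c z (k : R) xi xi' eta, charts A c -> cimg c z ->
    form c z (k *: xi + xi') eta = k * form c z xi eta + form c z xi' eta;
  form_alternating : forall c z xi eta, charts A c -> cimg c z ->
    form c z eta xi = - form c z xi eta;
  form_mulI : forall c z xi eta, charts A c -> cimg c z ->
    form c z (mulI xi) (mulI eta) = form c z xi eta;
  form_smooth : forall c xi eta, charts A c ->
    smooth_on (cimg c) (fun z => form c z xi eta);
  form_transition : forall c c' z xi eta,
    charts A c -> charts A c' -> overlap c c' z ->
    let tau := cmap c' \o cinv c in
    form c z xi eta = form c' (tau z) ('d tau z xi) ('d tau z eta) }.

Implicit Types (omega : form11) (u phi : X -> \bar R) (K : set X).

Definition closed_form omega := forall c z xi eta zeta,
  charts A c -> cimg c z ->
  'D_xi (fun w => omega c w eta zeta) z - 'D_eta (fun w => omega c w xi zeta) z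
    + 'D_zeta (fun w => omega c w xi eta) z = 0.

Definition semipositive omega := forall c z xi,
  charts A c -> cimg c z -> 0 <= omega c z xi (mulI xi).

Definition positive_form omega := forall c z xi,
  charts A c -> cimg c z -> xi != 0 -> 0 < omega c z xi (mulI xi).

Definition compact_kahler :=
  [/\ hausdorff_space X, compact [set: X]
    & exists2 kappa : form11, closed_form kappa & positive_form kappa].

(* A real (1,1)-current is positive iff its evaluation on (xi, i xi) is a
   positive distribution for each constant vector field xi. *)
Definition PSH omega : set (X -> \bar R) := [set phi |
  (forall c z, charts A c -> cimg c z ->
     exists W psi rho,
       [/\ open W, W z, W `<=` cimg c, psh_on W psi /\ smooth_on W rho
         & forall w, W w -> phi (cinv c w) = (psi w + (rho w)%:E)%E]) /\
  (forall c chi xi, charts A c -> test_function (cimg c) chi ->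
     (forall z, 0 <= chi z) ->
     (0 <= vol_int (cimg c)
             (pairing (omega c) (phi \o cinv c) chi xi (mulI xi)))%E)].

(* m = (omega + dd^c u)^n.  For u = 0 this is the measure defined by the top
   form omega^n. *)
Definition is_MA omega u (m : {measure set (borel X) -> \bar R}) :=
  forall c, charts A c -> exists T,
    bedford_taylor (cimg c) (omega c) (u \o cinv c) T /\
    forall chi, test_function (cimg c) chi ->
      (\int[m]_(x in cdom c) (chi (cmap c x))%:E)%E =
      signed_int (cimg c) (T n [::]) (EFin \o chi).

Definition capacity omega K : \bar R :=
  ereal_sup [set v | exists u (m : {measure set (borel X) -> \bar R}),
    [/\ PSH omega u, forall x, ((-1)%:E <= u x <= 0)%E, is_MA omega u m
      & v = m K]].

Definition choquet_int (C : set X -> \bar R) (f : X -> \bar R) (r : R) :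
    \bar R :=
  (r%:E * \int[@lebesgue_measure R]_(t in `]0%R, +oo[%classic)
            ((t `^ (r - 1))%R%:E * C [set x | t%:E <= f x]))%E.

Definition Ch omega (p : R) : set (X -> \bar R) := [set phi |
  PSH omega phi /\
  (choquet_int (capacity omega) (fun x => `|phi x|) (p + n%:R) < +oo)%E].

Definition Lq (mu : {measure set (borel X) -> \bar R}) (q : R) :
    set (X -> \bar R) := [set f |
  measurable_fun [set: borel X] (f : borel X -> \bar R) /\ (\int[mu]_x (`|f x| `^ q) < +oo)%E].

End Manifold.

(* Main.v *)
Require Import Defs.
From mathcomp Require Import all_boot all_order all_algebra.
From mathcomp Require Import all_classical all_reals all_analysis.
From mathcomp Require Import measurable_realfun.
From mathcomp Require Import ring lra.
Import Order.TTheory GRing.Theory Num.Theory.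
Import numFieldNormedType.Exports.
Local Open Scope classical_set_scope.
Local Open Scope ring_scope.

(** The class Ch^p says that the capacity of the superlevel sets of |phi|
    satisfies a strong-type integrability condition of exponent s = p + n.
    Its weak form is what the proof uses: the capacity of {|phi| >= t} is a
    nonincreasing function of t, so Chebyshev's inequality
    ([choquet_chebyshev]) bounds it by a constant times t^(-s).  Domination
    of mu by the power alpha of the capacity then gives
    mu {|phi| >= t} <= const * t^(- s alpha), i.e. phi is in weak
    L^(s alpha) (mu).  The hypothesis on alpha is exactly s alpha > q, and on a
    finite measure weak L^r is contained in L^q for q < r ([weak_Lr_sub_Lq]):
    cut the values of |phi|^q at the powers of 2 and sum a geometric series.

    Two facts about the complex geometry enter.  Functions in PSH are upper
    semicontinuous, being locally the sum of a plurisubharmonic and a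
    continuous function, hence Borel ([PSH_measurable]); this also makes the
    superlevel sets of |phi| Borel.  And the capacity, a supremum of measures,
    is monotone on Borel sets; it is nonnegative as soon as the supremum is
    taken over a nonempty family, which holds because it dominates a
    probability measure ([capacity_ge0]). *)

(** * Monotonicity of the integral and integrability from tail bounds *)

Section Integration.
Context {d : measure_display} {T : measurableType d} {R : realType}.
Variable mu : {measure set T -> \bar R}.
Local Open Scope ereal_scope.

Import HBNNSimple.

(** The integral of a nonnegative function is a supremum over the simple
    functions below it, so it is monotone on all nonnegative functions.  At
    this generality the inequality applies directly to the integrand of a
    Choquet integral. *)
Lemma ge0_le_integral_subset (D1 D2 : set T) (f1 f2 : T -> \bar R) :
  D1 `<=` D2 -> (forall x, D1 x -> 0 <= f1 x) -> (forall x, D2 x -> 0 <= f2 x) ->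
  (forall x, D1 x -> f1 x <= f2 x) ->
  \int[mu]_(x in D1) f1 x <= \int[mu]_(x in D2) f2 x.
Proof.
move=> D12 f1_ge0 f2_ge0 f12; rewrite !ge0_integralE//; apply: ereal_sup_le.
apply: image_subset => h /= hf1 x; apply: (le_trans (hf1 x)); rewrite !patchE.
case: ifPn => [/[!inE] D1x|_]; first by rewrite mem_set ?f12//; exact: D12.
by case: ifPn => [/[!inE]/f2_ge0|].
Qed.

(** If 2^k <= g x < 2^(k+1), the k-th term alone exceeds g x; the constant 1
    takes care of the points where g x < 1, and the series diverges where
    g x is infinite. *)
Lemma le_dyadic_series (g : T -> \bar R) (x : T) : 0 <= g x ->
  g x <= 1 + \sum_(0 <= k <oo)
    (2 ^+ k.+1 * \1_[set y : T | ((2 ^+ k)%:E <= g y)%E] x)%R%:E.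
Proof.
move=> g_ge0.
pose u k : \bar R := (2 ^+ k.+1 * \1_[set y : T | ((2 ^+ k)%:E <= g y)%E] x)%R%:E.
rewrite -/(\sum_(0 <= k <oo) u k); set S := 1 + _.
have u_ge0 k : 0 <= u k by rewrite lee_fin mulr_ge0 ?exprn_ge0.
(* Comparing with the reals below g x treats finite and infinite values of g x
   at once. *)
have le_S (y : R) : y%:E <= g x -> y%:E <= S.
  move=> yg; have [y1|y1] := leP y 1%R.
    apply: (@le_trans _ _ 1); first by rewrite lee_fin.
    by rewrite leeDl//; apply: nneseries_ge0 => k _ _; exact: u_ge0.
  have y_gt0 : (0 < y)%R by exact: lt_trans y1.
  have t_gt0 : (0 < Num.truncn y)%N by rewrite truncn_gt0 ltW.
  have /andP[ty yt] := truncn_itv (ltW y_gt0).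
  set k := trunc_log 2 (Num.truncn y).
  have ky : (2 ^+ k <= y)%R.
    by rewrite (le_trans _ ty)// -natrX ler_nat trunc_logP.
  have yk : (y <= 2 ^+ k.+1)%R.
    by rewrite (le_trans (ltW yt))// -natrX ler_nat trunc_log_ltn.
  apply: (@le_trans _ _ (u k)).
    rewrite lee_fin indicE mem_set ?mulr1//=.
    by rewrite (le_trans _ yg)// lee_fin.
  apply: (@le_trans _ _ (\sum_(0 <= i < k.+1) u i)).
    by rewrite big_nat_recr//= leeDr// sume_ge0.
  rewrite (le_trans (nneseries_lim_ge k.+1 (fun i _ _ => u_ge0 i)))//.
  by rewrite /S leeDr.
case: (g x) g_ge0 le_S => [y| |//] _ le_S; first exact: le_S.
(* At an infinite value of g x, a finite S would violate le_S at S + 1. *)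
have [->//|Sy] := eqVneq S +oo.
have S_ge0 : 0 <= S by rewrite (le_trans _ (le_S 0%R _))// leey.
have Sfin : S \is a fin_num by rewrite ge0_fin_numE// ltey.
have := le_S (fine S + 1)%R (leey _).
by rewrite EFinD fineK// -[leRHS]adde0 leeD2lE// lee_fin ler10.
Qed.

(** The dyadic series of f^q integrates to the sum of the
    2^(k+1) mu {f >= 2^(k/q)}, and the tail bound makes it a geometric series
    of ratio 2^(1 - r/q) < 1. *)
Lemma weak_Lr_sub_Lq (f : T -> \bar R) (q r K : R) :
  mu setT < +oo -> measurable_fun setT f -> (forall x, 0 <= f x) ->
  (0 < q)%R -> (q < r)%R ->
  (forall t : R, (0 < t)%R -> mu [set x | t%:E <= f x] <= (K * t `^ (- r))%:E) ->
  \int[mu]_x (f x `^ q) < +oo.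
Proof.
move=> mu_fin mf f_ge0 q_gt0 qr tail.
pose g x := f x `^ q.
have mg : measurable_fun setT g.
  exact: measurableT_comp (measurable_poweR _) mf.
have level_meas k : measurable [set y : T | ((2 ^+ k)%:E <= g y)%E].
  by rewrite -[X in measurable X]setTI; exact: emeasurable_fun_c_infty.
pose u k x : \bar R := (2 ^+ k.+1 * \1_[set y : T | ((2 ^+ k)%:E <= g y)%E] x)%R%:E.
have u_ge0 k x : 0 <= u k x by rewrite lee_fin mulr_ge0 ?exprn_ge0.
have mu_ k : measurable_fun setT (u k).
  by apply/measurable_EFinP; apply: measurable_funM => //; exact: measurable_indic.
have K_ge0 : (0 <= K)%R.
  have := le_trans (measure_ge0 _ _) (tail 1%R ltr01).
  by rewrite powR1 mulr1 lee_fin.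
pose z : R := (2 `^ (1 - r / q))%R.
have z_lt1 : (`|z| < 1)%R.
  rewrite ger0_norm ?powR_ge0// /z /powR pnatr_eq0/= expR_lt1.
  by rewrite pmulr_llt0 ?ln_gt0 ?ltr1n// subr_lt0 ltr_pdivlMr// mul1r.
have int_u k : \int[mu]_x u k x <= (geometric (2 * K) z k)%:E.
  rewrite (eq_integral (fun x => (2 ^+ k.+1)%:E *
      (\1_[set y : T | ((2 ^+ k)%:E <= g y)%E] x)%:E)); last by [].
  rewrite ge0_integralZl//; last by apply/measurable_EFinP; exact: measurable_indic.
  rewrite integral_indic// setIT.
  have t_gt0 : (0 < 2 `^ (k%:R / q) :> R)%R by rewrite powR_gt0.
  rewrite (@le_trans _ _ ((2 ^+ k.+1)%:E *
      (K * (2 `^ (k%:R / q)) `^ (- r))%:E))//.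
    apply: lee_wpmul2l; first by rewrite lee_fin exprn_ge0.
    apply: le_trans (tail _ t_gt0); apply: le_measure; rewrite ?inE//.
      by rewrite -[X in measurable X]setTI; exact: emeasurable_fun_c_infty.
    move=> x /= kg; rewrite leNgt; apply/negP => fx.
    move: kg; rewrite leNgt => /negP; apply.
    have f_fin : f x \is a fin_num by rewrite ge0_fin_numE// (lt_trans fx)// ltry.
    move: fx; rewrite /g -(fineK f_fin) poweR_EFin !lte_fin => fx.
    rewrite (@lt_le_trans _ _ ((2 `^ (k%:R / q)) `^ q)%R)//.
      by apply: gt0_ltr_powR => //; rewrite nnegrE ?fine_ge0 ?powR_ge0.
    by rewrite -powRrM mulfVK ?gt_eqF// powR_mulrn.
  rewrite -EFinM lee_fin /geometric/= -powRrM -[(z ^+ k)%R]powR_mulrn ?powR_ge0//.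
  rewrite -powRrM mulrBl mul1r powRD; last by rewrite pnatr_eq0 implybT.
  rewrite powR_mulrn// exprS.
  have -> : (k%:R / q * - r = - (r / q * k%:R))%R by ring.
  by rewrite le_eqVlt; apply/orP; left; apply/eqP; ring.
rewrite (@le_lt_trans _ _ (mu setT + \sum_(0 <= k <oo) \int[mu]_x u k x))//.
  have <- : \int[mu]_x (1 + \sum_(0 <= k <oo) u k x) =
      mu setT + \sum_(0 <= k <oo) \int[mu]_x u k x.
    rewrite ge0_integralD//.
    - by rewrite integral_cst// mul1e integral_nneseries.
    - by move=> x _; apply: nneseries_ge0.
    - exact: (@ge0_emeasurable_sum _ _ _ _ u predT).
  apply: ge0_le_integral_subset => // x _; first exact: poweR_ge0.
    by apply: adde_ge0 => //; apply: nneseries_ge0.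
  exact/le_dyadic_series/poweR_ge0.
rewrite lte_add_pinfty//.
rewrite (@le_lt_trans _ _ (\sum_(0 <= k <oo) (geometric (2 * K) z k)%:E))//.
  by apply: lee_nneseries => // k _ _; exact: integral_ge0.
have z_gt0 : (0 < z)%R by rewrite powR_gt0.
apply: (@le_lt_trans _ _ (2 * K * (1 - z)^-1)%:E); last exact: ltry.
apply: lime_le.
  by apply: is_cvg_nneseries => k _ _; rewrite lee_fin geometric_ge0 ?mulr_ge0// ltW.
apply: nearW => m; rewrite sumEFin lee_fin.
by rewrite (geometric_le_lim m)// mulr_ge0.
Qed.

End Integration.

(** * Chebyshev's inequality for Choquet integrals *)

Section Choquet.
Context {R : realType} {X : ptopologicalType}.
Variables (C : set X -> \bar R) (f : X -> \bar R).
Local Open Scope ereal_scope.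

Hypothesis C_ge0 : forall t : R, 0 <= C [set x | t%:E <= f x].
Hypothesis C_antitone : forall t t' : R, (t <= t')%R ->
  C [set x | t'%:E <= f x] <= C [set x | t%:E <= f x].

(** By monotonicity the integrand is at least (t/2)^(r-1) C {f >= t} on
    ]t/2, t], an interval of length t/2; the constant is not optimal, but
    no primitive of a power has to be computed.  The factor r >= 1 in front of
    the integral is discarded. *)
Lemma choquet_chebyshev (r t : R) : (1 <= r)%R -> (0 < t)%R ->
  ((t / 2) `^ r)%:E * C [set x | t%:E <= f x] <= choquet_int C f r.
Proof.
move=> r_ge1 t_gt0; set c := C _.
have t2_gt0 : (0 < t / 2)%R by rewrite divr_gt0.
have F_ge0 (s : R) : 0 <= (s `^ (r - 1))%:E * C [set x | s%:E <= f x].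
  by rewrite mule_ge0// lee_fin powR_ge0.
have v_ge0 : 0 <= ((t / 2) `^ (r - 1))%:E * c.
  by rewrite mule_ge0 ?lee_fin ?powR_ge0//; exact: C_ge0.
rewrite /choquet_int; set J := \int[_]_(_ in _) _.
have J_ge : ((t / 2) `^ r)%:E * c <= J.
  have -> : ((t / 2) `^ r)%:E * c =
      \int[@lebesgue_measure R]_(s in `](t / 2)%R, t]%classic)
        cst (((t / 2) `^ (r - 1))%:E * c) s.
    rewrite integral_cst// [X in _ = _ * X](_ : _ = (t / 2)%:E); last first.
      rewrite [LHS](lebesgue_measure_itv `](t / 2)%R, t])/= lte_fin.
      rewrite ltr_pdivrMr// ltr_pMr// ltr1n -EFinD.
      by congr EFin; field.
    rewrite -[in LHS](@mulr_powRB1 _ (t / 2) r) ?ltW// ?(lt_le_trans ltr01)//.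
    by rewrite EFinM -muleA muleC.
  apply: ge0_le_integral_subset => // s /=.
    rewrite !in_itv/= => /andP[ts _]; rewrite andbT; exact: lt_trans ts.
  rewrite in_itv/= => /andP[ts st]; apply: lee_pmul.
  - by rewrite lee_fin powR_ge0.
  - exact: C_ge0.
  - rewrite lee_fin ge0_ler_powR ?subr_ge0// ?nnegrE ?ltW//.
    exact: lt_trans ts.
  - exact: C_antitone.
apply: (le_trans J_ge); rewrite -[leLHS]mul1e lee_wpmul2r//.
by rewrite (le_trans _ J_ge)// mule_ge0 ?lee_fin ?powR_ge0//; exact: C_ge0.
Qed.

End Choquet.

(** * Quasi-plurisubharmonic functions and the Monge-Ampere capacity *)

Section PluripotentialTheory.
Context {R : realType} {X : ptopologicalType} {n : nat}.
Context {A : complex_atlas R X n} (omega : form11 A).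
Local Open Scope ereal_scope.

(** In a chart phi = psi + rho with psi upper semicontinuous and rho
    continuous.  The real number a below splits the inequality
    psi + rho < b into psi < a and rho < b - a, which avoids sums with
    infinite values of psi. *)
Lemma PSH_usc (phi : X -> \bar R) (b : R) :
  PSH omega phi -> open [set x | phi x < b%:E].
Proof.
move=> [phi_loc _]; rewrite openE => x /= phix.
have [c Ac cx] := charts_cover A x.
have [W [psi [rho [oW Wz _ [psh_psi smooth_rho] phiE]]]] :=
  phi_loc c (cmap c x) Ac (cmap_img cx).
have [_ psi_usc _ _] := psh_psi.
have rho_cont : {for cmap c x, continuous rho}.
  by have [] := smooth_rho [::] (cmap c x) Wz.
have phixE := phiE _ Wz; rewrite cmapK// in phixE.
have [a psia arho] : exists2 a : R, psi (cmap c x) < a%:E & (a + rho (cmap c x) < b)%R.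
  move: phix; rewrite phixE; case: (psi _) => [y| |]//.
    rewrite -EFinD lte_fin => yb.
    by exists ((y + (b - rho (cmap c x))) / 2)%R; rewrite ?lte_fin; lra.
  by move=> _; exists (b - rho (cmap c x) - 1)%R; [rewrite ltNyr|lra].
have near_z : \forall w \near cmap c x,
    [/\ W w, psi w < a%:E & (rho w < b - a)%R].
  have rho_near : \forall w \near cmap c x, (rho w < b - a)%R.
    by apply: (cvgr_lt (rho (cmap c x)) rho_cont); rewrite ltrBrDl.
  have W_near : \forall w \near cmap c x, W w by exact: open_nbhs_nbhs.
  by have psi_near := psi_usc _ _ Wz psia; near=> w; split; near: w.
have dom_near : \forall y \near x, cdom c y.
  by apply: open_nbhs_nbhs; split => //; exact: cdom_open.
have near_x := cmap_continuous cx near_z.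
rewrite /interior; near=> y.
have cy : cdom c y by near: y.
have [Ww psi_lt rho_lt] : [/\ W (cmap c y), psi (cmap c y) < a%:E &
  (rho (cmap c y) < b - a)%R] by near: y.
rewrite -[y](cmapK cy) /= phiE//.
rewrite (_ : b = a + (b - a))%R; last by rewrite addrC subrK.
by rewrite EFinD lteD// lte_fin.
Unshelve. all: by end_near. Qed.

Lemma PSH_measurable (phi : X -> \bar R) : PSH omega phi ->
  measurable_fun [set: borel X] (phi : borel X -> \bar R).
Proof.
move=> psh_phi; apply: (measurability _ (ErealGenInftyO.measurableE R)).
move=> /= _ [_ [b ->]] <-; rewrite setTI preimage_itvNyo.
by apply: sub_sigma_algebra; exact: PSH_usc.
Qed.

Lemma capacity_ge_measure u (m : {measure set (borel X) -> \bar R}) (K : set X) :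
  PSH omega u -> (forall x, (-1)%:E <= u x <= 0) -> is_MA omega u m ->
  m K <= capacity omega K.
Proof. by move=> psh_u u_bd mau; apply: ereal_sup_ubound; exists u, m. Qed.

Lemma le_capacity (K L : set (borel X)) : measurable K -> measurable L ->
  K `<=` L -> capacity omega K <= capacity omega L.
Proof.
move=> mK mL KL; apply: ge_ereal_sup => _ [u [m [psh_u u_bd mau ->]]].
apply: le_trans (capacity_ge_measure _ _ L psh_u u_bd mau).
by apply: le_measure; rewrite ?inE.
Qed.

(** An empty supremum is -oo, so the value -oo on one set means that there is
    no competitor at all; otherwise the capacity of any set is at least its
    mass for some measure. *)
Lemma capacity_ge0 (K L : set X) :
  capacity omega L != -oo -> 0 <= capacity omega K.
Proof.
move=> L_Ny; apply/negPn/negP => capK; move/eqP: L_Ny; apply.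
apply/eqP; rewrite -leeNy_eq; apply: ge_ereal_sup => v [u [m [psh_u u_bd mau _]]].
move: capK; rewrite (le_trans _ (capacity_ge_measure _ _ K psh_u u_bd mau))//.
Qed.

End PluripotentialTheory.

Theorem proposition3p3 (R : realType) (X : ptopologicalType) (n : nat)
    (n_gt0 : (0 < n)%N) (A : complex_atlas R X n) (X_kahler : compact_kahler A)
    (omega : form11 A) (omega_closed : closed_form omega)
    (omega_semipositive : semipositive omega)
    (omega_volume : exists2 vol : {measure set (borel X) -> \bar R},
      is_MA omega (cst 0%E) vol & vol [set: X] = 1%E)
    (p q : R) (p_ge1 : 1 <= p) (q_gt0 : 0 < q)
    (mu : probability (borel X) R)
    (C alpha : R) (C_gt0 : 0 < C)
    (alpha_gt : q / (p + n%:R) < alpha) (alpha_lt1 : alpha < 1)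
    (mu_le : forall B : set (borel X), measurable B ->
      (mu B <= C%:E * capacity omega B `^ alpha)%E) :
  Ch omega p `<=` Lq mu q.
Proof.
move=> phi [psh_phi phi_choquet].
have mphi := PSH_measurable omega _ psh_phi.
split => //.
set s := p + n%:R in alpha_gt phi_choquet.
have s_ge1 : 1 <= s by rewrite (le_trans p_ge1)// lerDl.
have s_gt0 : 0 < s by exact: lt_le_trans s_ge1.
have alpha_gt0 : 0 < alpha by rewrite (lt_trans _ alpha_gt)// divr_gt0.
have mset (t : R) : measurable ([set x | (t%:E <= `|phi x|)%E] : set (borel X)).
  rewrite -[X in measurable X]setTI; apply: emeasurable_fun_c_infty => //.
  exact: measurableT_comp.
(* If the family of competitors were empty, the power alpha of the capacity of X
   would be 0, contradicting mu X = 1. *)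
have cap_ge0 (K : set X) : (0 <= capacity omega K)%E.
  apply: (@capacity_ge0 _ _ _ _ _ _ [set: X]); apply/eqP => cap_Ny.
  have := mu_le _ measurableT; rewrite cap_Ny poweRNyr ?gt_eqF// mule0.
  by rewrite probability_setT lee_fin ler10.
have cap_anti (t t' : R) : t <= t' ->
    (capacity omega [set x | (t'%:E <= `|phi x|)%E] <=
     capacity omega [set x | (t%:E <= `|phi x|)%E])%E.
  move=> tt'; apply: le_capacity; [exact: mset|exact: mset|].
  by move=> x /=; apply: le_trans; rewrite lee_fin.
set I := choquet_int _ _ _ in phi_choquet.
have chebyshev (t : R) : 0 < t ->
    (((t / 2) `^ s)%:E * capacity omega [set x | (t%:E <= `|phi x|)%E] <= I)%E.
  by move=> t_gt0; apply: choquet_chebyshev.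
have I_ge0 : (0 <= I)%E.
  by apply: le_trans (chebyshev 1 ltr01); rewrite mule_ge0// lee_fin powR_ge0.
have I_fin : I \is a fin_num by rewrite ge0_fin_numE.
pose M := fine I * 2 `^ s.
have M_ge0 : 0 <= M by rewrite mulr_ge0 ?fine_ge0 ?powR_ge0.
have cap_tail (t : R) : 0 < t ->
    (capacity omega [set x | (t%:E <= `|phi x|)%E] <= (M * t `^ (- s))%:E)%E.
  move=> t_gt0; have t2_gt0 : 0 < (t / 2) `^ s by rewrite powR_gt0 ?divr_gt0.
  have -> : M * t `^ (- s) = ((t / 2) `^ s)^-1 * fine I.
    rewrite /M powRM ?invr_ge0 ?ltW// -[2^-1]powR_inv1// -powRrM mulN1r !powRN.
    by rewrite invfM invrK; ring.
  by rewrite EFinM fineK// lee_pdivlMl//; exact: chebyshev.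
apply: (weak_Lr_sub_Lq mu _ q (s * alpha) (C * M `^ alpha)) => //.
- by apply: le_lt_trans (probability_le1 mu measurableT) _; exact: ltry.
- exact: measurableT_comp.
- by rewrite mulrC -ltr_pdivrMr.
move=> t t_gt0; apply: le_trans (mu_le _ (mset t)) _.
rewrite -mulrA EFinM lee_wpmul2l ?lee_fin ?(ltW C_gt0)//.
rewrite -mulNr powRrM -powRM ?powR_ge0// -poweR_EFin.
apply: gt0_ler_poweR; rewrite ?(ltW alpha_gt0)// ?in_itv/= ?cap_ge0 ?leey//.
  by rewrite lee_fin mulr_ge0 ?powR_ge0.
exact: cap_tail.
Qed.
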